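(* $\mathfrak{LP}_d$, whose objects are the discrete Lagrange--Poincaré systems and whose morphisms are as defined in the context, is a category when considering the standard composition of functions and the identity mappings $id_{\mathcal M}:=id_{C'(E)}$ for $\mathcal M=(E,L_d,\mathcal P)$.
   Context: $p_j$ is the projection of a Cartesian product on its $j$-th factor; $D_j$ is the restriction of the differential to the $j$-th factor of a product. A fiber bundle $(E,M,\phi,F)$ is a smooth map $\phi:E\to M$ of manifolds such that every $m\in M$ has an open neighborhood $U$ and a diffeomorphism $\Phi_U:\phi^{-1}(U)\to U\times F$ with $p_1\circ\Phi_U=\phi$. For a fiber bundle $\phi:E\to M$ put $C'(E)=E\times M$ and $C''(E)=\{((\epsilon_0,m_1),(\epsilon_1,m_2))\in C'(E)^2: m_1=\phi(\epsilon_1)\}$. A discrete Lagrange--Poincaré system (DLPS) over $E$ is $\mathcal M=(E,L_d,\mathcal P)$ with $L_d:C'(E)\to\mathbb R$ smooth and $\mathcal P$ an infinitesimal variation chaining map: a smooth family of linear maps $\mathcal P((\epsilon_0,m_1),(\epsilon_1,m_2)):T_{\epsilon_1}E\to\ker d\phi(\epsilon_0)\subset T_{\epsilon_0}E$ indexed by $C''(E)$ (a vector bundle homomorphism). A morphism in $\mathfrak{LP}_d$ from $(E,L_d,\mathcal P)$ (over $\phi:E\to M$) to $(E',L_d',\mathcal P')$ (over $\phi':E'\to M'$) is a map $\Upsilon:C'(E)\to C'(E')$ such that: (1) $\Upsilon$ is a surjective submersion; (2) $D_1(p_1\circ\Upsilon)(\epsilon_0,m_1):T_{\epsilon_0}E\to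 T_{p_1(\Upsilon(\epsilon_0,m_1))}E'$ is onto for all $(\epsilon_0,m_1)\in C'(E)$; (3) $D_1(p_2\circ\Upsilon)(\epsilon_0,m_1)=0$ for all $(\epsilon_0,m_1)\in C'(E)$; (4) for all $((\epsilon_0,m_1),(\epsilon_1,m_2))\in C''(E)$, $p_2(\Upsilon(\epsilon_0,m_1))=\phi'(p_1(\Upsilon(\epsilon_1,m_2)))$, so that $\Upsilon\times\Upsilon$ restricts to $\Upsilon^{(2)}:C''(E)\to C''(E')$; (5) $L_d=L_d'\circ\Upsilon$; (6) for all $\eta=((\epsilon_0,m_1),(\epsilon_1,m_2))\in C''(E)$ and $\delta\epsilon_1\in T_{\epsilon_1}E$, $\mathcal P'(\Upsilon^{(2)}(\eta))(D_1(p_1\circ\Upsilon)(\epsilon_1,m_2)(\delta\epsilon_1))=d(p_1\circ\Upsilon)(\epsilon_0,m_1)(\mathcal P(\eta)(\delta\epsilon_1),d\phi(\epsilon_1)(\delta\epsilon_1))$. *)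

(* Defs.v *)
From HB Require Import structures.
From mathcomp Require Import all_boot all_order all_algebra.
From mathcomp Require Import all_classical all_reals all_analysis.
Set Implicit Arguments.
Unset Strict Implicit.
Unset Printing Implicit Defensive.
Import Order.TTheory GRing.Theory Num.Theory.
Import numFieldNormedType.Exports.
Local Open Scope classical_set_scope.
Local Open Scope ring_scope.

(* Only meant for open U and a finite-dimensional V, where it is the usual
   notion: all iterated directional derivatives exist and are continuous. *)
Fixpoint Ck_on (R : realType) (V W : normedModType R) (k : nat)
    (U : set V) (f : V -> W) : Prop :=
  if k is k'.+1 then
    (forall x, U x -> differentiable f x) /\ (forall v, Ck_on k' U ('D_v f))
  else forall x, U x -> {for x, continuous f}.

Definition smooth_on (R : realType) (V W : normedModType R)
    (U : set V) (f : V -> W) : Prop := forall k, Ck_on k U f.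

(* [chart_map] and [chart_inv] are total functions; their values outside
   [chart_dom], resp. [chart_cod], are irrelevant. *)
Record chart (R : realType) (T : topologicalType) (n : nat) := Chart {
  chart_dom : set T ;
  chart_cod : set 'rV[R]_n ;
  chart_map :> T -> 'rV[R]_n ;
  chart_inv : 'rV[R]_n -> T ;
  chart_dom_open : open chart_dom ;
  chart_cod_open : open chart_cod ;
  chart_mapP : forall x, chart_dom x -> chart_cod (chart_map x) ;
  chart_invP : forall v, chart_cod v -> chart_dom (chart_inv v) ;
  chart_mapK : forall x, chart_dom x -> chart_inv (chart_map x) = x ;
  chart_invK : forall v, chart_cod v -> chart_map (chart_inv v) = v ;
  chart_map_continuous :
    forall x, chart_dom x -> {for x, continuous chart_map} ;
  chart_inv_continuous :
    forall v, chart_cod v -> {for v, continuous chart_inv} }.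

Definition overlap (R : realType) (T : topologicalType) (n : nat)
    (c d : chart R T n) : set 'rV[R]_n :=
  chart_cod c `&` chart_inv c @^-1` chart_dom d.

(* The charts [chart_at x] form the atlas; [chart_at x] is moreover the chart
   used to represent the tangent space at x. *)
Record manifold (R : realType) := Manifold {
  carrier :> topologicalType ;
  mdim : nat ;
  chart_at : carrier -> chart R carrier mdim ;
  chart_at_dom : forall x, chart_dom (chart_at x) x ;
  chart_at_compat : forall x y,
    smooth_on (overlap (chart_at x) (chart_at y))
              (chart_at y \o chart_inv (chart_at x)) ;
  mhausdorff : hausdorff_space carrier ;
  msecond_countable : @second_countable carrier }.
Arguments chart_at {R} _ _.

(* In the next two definitions, W is meant to be open. *)
Definition smooth_fun_on (R : realType) (M : manifold R) (V : normedModType R)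
    (W : set M) (f : M -> V) : Prop :=
  forall x, smooth_on
    (chart_cod (chart_at M x) `&` chart_inv (chart_at M x) @^-1` W)
    (f \o chart_inv (chart_at M x)).

Definition smooth_map_on (R : realType) (M N : manifold R)
    (W : set M) (f : M -> N) : Prop :=
  (forall x, W x -> {for x, continuous f}) /\
  (forall y, smooth_fun_on (W `&` f @^-1` chart_dom (chart_at N y))
                           (chart_at N y \o f)).

Definition smooth_map (R : realType) (M N : manifold R) (f : M -> N) : Prop :=
  smooth_map_on setT f.

(* Restricted to A, f is a diffeomorphism onto B. *)
Definition diffeo_on (R : realType) (M N : manifold R)
    (A : set M) (B : set N) (f : M -> N) : Prop :=
  smooth_map_on A f /\ (forall x, A x -> B (f x)) /\
  exists g : N -> M,
    [/\ smooth_map_on B g, forall y, B y -> A (g y),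
        forall x, A x -> g (f x) = x & forall y, B y -> f (g y) = y].

(* A tangent vector at x is represented by its components in the chart
   [chart_at M x]. *)
Definition tangent (R : realType) (M : manifold R) (x : M) : normedModType R :=
  'rV[R]_(mdim M).

Definition mdiff (R : realType) (M N : manifold R) (f : M -> N) (x : M) :
    {linear tangent x -> tangent (f x)} :=
  'd (chart_at N (f x) \o f \o chart_inv (chart_at M x)) (chart_at M x x).

(* How the components of a tangent vector at x change from chart c to d. *)
Definition coord_change (R : realType) (T : topologicalType) (n : nat)
    (c d : chart R T n) (x : T) : {linear 'rV[R]_n -> 'rV[R]_n} :=
  'd (d \o chart_inv c) (c x).

Definition submersion (R : realType) (M N : manifold R) (f : M -> N) : Prop :=
  smooth_map f /\
  forall x (w : tangent (f x)), exists v : tangent x, mdiff f x v = w.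

Section ProductManifold.
Context (R : realType).

Definition row_pair (m n : nat) (p : 'rV[R]_m * 'rV[R]_n) : 'rV[R]_(m + n) :=
  row_mx p.1 p.2.

Lemma row_pair_is_linear m n : linear (@row_pair m n).
Proof. by move=> a p q; rewrite /row_pair scale_row_mx add_row_mx. Qed.

HB.instance Definition _ m n :=
  GRing.isLinear.Build R ('rV[R]_m * 'rV[R]_n)%type 'rV[R]_(m + n) _
    (@row_pair m n) (@row_pair_is_linear m n).

Lemma row_pair_continuous m n : continuous (@row_pair m n).
Proof.
move=> [a b] A /nbhs_ballP[e /= e0 eA].
apply/nbhs_ballP; exists e => //= -[c d] [/= [_ ac] [_ bd]].
apply: eA; split => // i j; rewrite !mxE; case: (fintype.split j) => k.
  exact: ac.
exact: bd.
Qed.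

Lemma pair_continuous_at (S T U : topologicalType) (f : S -> T) (g : S -> U) x :
  {for x, continuous f} -> {for x, continuous g} ->
  {for x, continuous (fun y => (f y, g y))}.
Proof. exact: cvg_pair. Qed.

Lemma open_submx (m n : nat) (U : set 'rV[R]_m) (V : set 'rV[R]_n) :
  open U -> open V ->
  open [set v : 'rV[R]_(m + n) | U (lsubmx v) /\ V (rsubmx v)].
Proof.
move=> Uo Vo; apply: openI.
  by apply: (@open_comp _ _ lsubmx _ _ Uo) => v _; exact: continuous_lsubmx.
by apply: (@open_comp _ _ rsubmx _ _ Vo) => v _; exact: continuous_rsubmx.
Qed.

Lemma near_differentiable (V W : normedModType R) (f g : V -> W) (x : V) :
  (\near x, f x = g x) -> differentiable f x -> differentiable g x.
Proof.
move=> fg df; have [dfc /eqaddoP dfE] := (diff_locallyP x f).1 df.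
have fgx := nbhs_singleton fg.
have gE : g \o shift x = cst (g x) + 'd f x +o_ 0 id.
  apply/eqaddoP => e e0; have := dfE e e0.
  have : \forall h \near 0, f (h + x) = g (h + x).
    by move: fg; rewrite (near_shift 0 x); apply: filterS => h /=; rewrite subr0.
  by apply: filterS2 => h /= fgh; rewrite /= !fctE /= fgh fgx.
by apply/diff_locallyP; rewrite (diff_unique dfc gE).
Qed.

Lemma eq_Ck_on (V W : normedModType R) k (U : set V) (f g : V -> W) :
  open U -> (forall x, U x -> f x = g x) -> Ck_on k U f -> Ck_on k U g.
Proof.
move=> Uo; elim: k f g => [|k IH] f g fg /=.
  move=> fc x Ux; have fgx : \near x, f x = g x.
    by apply: filterS fg _; exact: open_nbhs_nbhs.
  have fx : f @ x --> f x := fc x Ux.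
  have gx : g @ x --> g x by rewrite -fg//; exact: cvg_trans (near_eq_cvg fgx) fx.
  exact: gx.
move=> [fd fD]; have fgn x : U x -> \near x, f x = g x.
  by move=> Ux; apply: filterS fg _; exact: open_nbhs_nbhs.
split=> [x Ux|v]; first exact: near_differentiable (fgn x Ux) (fd x Ux).
by apply: IH (fD v) => x Ux; exact: near_eq_derive (fgn x Ux).
Qed.

Section ProdFun.
Context (m m' n n' : nat).
Implicit Types (f : 'rV[R]_m -> 'rV[R]_m') (g : 'rV[R]_n -> 'rV[R]_n').

Let prodf f g (v : 'rV[R]_(m + n)) : 'rV[R]_(m' + n') :=
  row_mx (f (lsubmx v)) (g (rsubmx v)).

Let is_diff_prodf f g v : differentiable f (lsubmx v) ->
  differentiable g (rsubmx v) ->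
  differentiable (prodf f g) v /\
  forall w, 'D_w (prodf f g) v =
    row_mx ('D_(lsubmx w) f (lsubmx v)) ('D_(rsubmx w) g (rsubmx v)).
Proof.
move=> df dg.
have dl := @differentiable_lsubmx R 1 m n v.
have dr := @differentiable_rsubmx R 1 m n v.
have dfl := differentiable_comp dl df.
have dgr := differentiable_comp dr dg.
pose h (u : 'rV[R]_(m + n)) := (f (lsubmx u), g (rsubmx u)).
have dh : differentiable h v by exact: differentiable_pair dfl dgr.
have dhE w : 'd h v w = ('d f (lsubmx v) (lsubmx w), 'd g (rsubmx v) (rsubmx w)).
  rewrite (_ : 'd h v w = ('d (f \o lsubmx) v w, 'd (g \o rsubmx) v w)); last first.
    by have /(congr1 (@^~ w)) := diff_pair dfl dgr.
  rewrite (diff_comp dl df) (diff_comp dr dg) /=.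
  rewrite (diff_lin _ (@continuous_lsubmx R 1 m n)).
  by rewrite (diff_lin _ (@continuous_rsubmx R 1 m n)).
have rc := @row_pair_continuous m' n'.
have dR : differentiable (@row_pair m' n') (h v) by exact: linear_differentiable.
have dP : differentiable (prodf f g) v := differentiable_comp dh dR.
split=> // w; rewrite (deriveE w dP) (deriveE _ df) (deriveE _ dg).
have /(congr1 (@^~ w)) := diff_comp dh dR.
rewrite (diff_lin _ rc) /= dhE.
exact.
Qed.

Lemma Ck_on_prod k (U : set 'rV[R]_m) (V : set 'rV[R]_n) f g :
  open U -> open V -> Ck_on k U f -> Ck_on k V g ->
  Ck_on k [set v | U (lsubmx v) /\ V (rsubmx v)]
    (fun v => row_mx (f (lsubmx v)) (g (rsubmx v))).
Proof.
move=> Uo Vo; elim: k f g => [|k IH] f g /=.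
  move=> fc gc v [Uv Vv].
  apply: (@continuous_comp _ _ _ (fun v => (f (lsubmx v), g (rsubmx v)))
    (@row_pair _ _)); last exact: row_pair_continuous.
  apply: pair_continuous_at.
    by apply: (@continuous_comp _ _ _ lsubmx f);
      [exact: continuous_lsubmx|exact: fc].
  by apply: (@continuous_comp _ _ _ rsubmx g);
    [exact: continuous_rsubmx|exact: gc].
move=> [fd fD] [gd gD]; split=> [v [Uv Vv]|w].
  by have [] := is_diff_prodf (fd _ Uv) (gd _ Vv).
apply: eq_Ck_on (IH _ _ (fD (lsubmx w)) (gD (rsubmx w))).
  exact: open_submx.
by move=> v [Uv Vv]; have [_ ->] := is_diff_prodf (fd _ Uv) (gd _ Vv).
Qed.

End ProdFun.

Section ProdChart.
Context (S T : topologicalType) (m n : nat).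
Context (c : chart R S m) (d : chart R T n).

Definition prod_chart_dom : set (S * T) :=
  [set p | chart_dom c p.1 /\ chart_dom d p.2].
Definition prod_chart_cod : set 'rV[R]_(m + n) :=
  [set v | chart_cod c (lsubmx v) /\ chart_cod d (rsubmx v)].
Definition prod_chart_map (p : S * T) : 'rV[R]_(m + n) :=
  row_mx (c p.1) (d p.2).
Definition prod_chart_inv (v : 'rV[R]_(m + n)) : S * T :=
  (chart_inv c (lsubmx v), chart_inv d (rsubmx v)).

Lemma prod_chart_dom_open : open prod_chart_dom.
Proof.
apply: openI.
  by apply: (@open_comp _ _ fst _ _ (chart_dom_open c)) => p _; exact: cvg_fst.
by apply: (@open_comp _ _ snd _ _ (chart_dom_open d)) => p _; exact: cvg_snd.
Qed.

Lemma prod_chart_cod_open : open prod_chart_cod.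
Proof.
by apply: (@open_submx m n); exact: chart_cod_open.
Qed.

Lemma prod_chart_mapP p : prod_chart_dom p -> prod_chart_cod (prod_chart_map p).
Proof.
by move=> [? ?]; split; rewrite /= ?row_mxKl ?row_mxKr; exact: chart_mapP.
Qed.

Lemma prod_chart_invP v : prod_chart_cod v -> prod_chart_dom (prod_chart_inv v).
Proof. by move=> [? ?]; split; exact: chart_invP. Qed.

Lemma prod_chart_mapK p :
  prod_chart_dom p -> prod_chart_inv (prod_chart_map p) = p.
Proof.
case: p => x y [/= ? ?]; rewrite /prod_chart_inv row_mxKl row_mxKr /=.
by rewrite !chart_mapK.
Qed.

Lemma prod_chart_invK v :
  prod_chart_cod v -> prod_chart_map (prod_chart_inv v) = v.
Proof.
by move=> [? ?]; rewrite /prod_chart_map /= !chart_invK// hsubmxK.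
Qed.

Lemma prod_chart_map_continuous p :
  prod_chart_dom p -> {for p, continuous prod_chart_map}.
Proof.
move=> [cp dp].
apply: (@continuous_comp _ _ _ (fun p : S * T => (c p.1, d p.2))
  (@row_pair _ _)); last exact: row_pair_continuous.
apply: pair_continuous_at.
  by apply: (@continuous_comp _ _ _ fst c);
    [exact: cvg_fst|exact: chart_map_continuous].
by apply: (@continuous_comp _ _ _ snd d);
  [exact: cvg_snd|exact: chart_map_continuous].
Qed.

Lemma prod_chart_inv_continuous v :
  prod_chart_cod v -> {for v, continuous prod_chart_inv}.
Proof.
move=> [cv dv]; apply: pair_continuous_at.
  by apply: (@continuous_comp _ _ _ lsubmx (chart_inv c));
    [exact: continuous_lsubmx|exact: chart_inv_continuous].
by apply: (@continuous_comp _ _ _ rsubmx (chart_inv d));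
  [exact: continuous_rsubmx|exact: chart_inv_continuous].
Qed.

Definition prod_chart : chart R (S * T)%type (m + n) :=
  Chart prod_chart_dom_open prod_chart_cod_open prod_chart_mapP prod_chart_invP
    prod_chart_mapK prod_chart_invK prod_chart_map_continuous
    prod_chart_inv_continuous.

End ProdChart.

Lemma overlap_open (T : topologicalType) (n : nat) (c d : chart R T n) :
  open (overlap c d).
Proof.
rewrite openE => v [cv dv]; apply: filterI.
  by apply: open_nbhs_nbhs; split=> //; exact: chart_cod_open.
apply: (chart_inv_continuous cv); apply: open_nbhs_nbhs; split=> //.
exact: chart_dom_open.
Qed.

Lemma prod_hausdorff (S T : topologicalType) :
  hausdorff_space S -> hausdorff_space T -> hausdorff_space (S * T)%type.
Proof.
move=> hS hT [x y] [x' y'] cl; congr pair.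
  apply: hS => A B Ax Bx'.
  have [] := cl (fst @^-1` A) (fst @^-1` B) (cvg_fst Ax) (cvg_fst Bx').
  by move=> p [? ?]; exists p.1.
apply: hT => A B Ay By'.
have [] := cl (snd @^-1` A) (snd @^-1` B) (cvg_snd Ay) (cvg_snd By').
by move=> p [? ?]; exists p.2.
Qed.

Lemma prod_second_countable (S T : topologicalType) :
  @second_countable S -> @second_countable T ->
  @second_countable (S * T)%type.
Proof.
move=> [B Bc [Bo BB]] [C Cc [Co CB]].
exists [set P.1 `*` P.2 | P in B `*` C].
  apply: (sub_countable (card_image_le _ _)); exact: countableX.
split=> [_ [[P Q] [/= BP CQ] <-]|[x y] A [[P Q] /= [Px Qy] PQA]].
  apply: openI.
    by apply: (@open_comp _ _ fst _ _ (Bo _ BP)) => p _; exact: cvg_fst.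
  by apply: (@open_comp _ _ snd _ _ (Co _ CQ)) => p _; exact: cvg_snd.
have [U [BU Ux] UP] := BB x _ Px; have [V [CV Vy] VQ] := CB y _ Qy.
exists (U `*` V) => /=; first by split=> //; exists (U, V).
by apply: subset_trans PQA => -[a b] [/= /UP ? /VQ ?].
Qed.

Section ProdManifold.
Context (M N : manifold R).

Definition prod_chart_at (p : M * N) :
    chart R (carrier M * carrier N)%type (mdim M + mdim N) :=
  prod_chart (chart_at M p.1) (chart_at N p.2).

Lemma prod_chart_at_dom p : chart_dom (prod_chart_at p) p.
Proof. by split; exact: chart_at_dom. Qed.

Lemma prod_chart_at_compat p q :
  smooth_on (overlap (prod_chart_at p) (prod_chart_at q))
            (prod_chart_at q \o chart_inv (prod_chart_at p)).
Proof.
move=> k.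
have := Ck_on_prod (@overlap_open _ _ _ _) (@overlap_open _ _ _ _)
  (@chart_at_compat _ M p.1 q.1 k) (@chart_at_compat _ N p.2 q.2 k).
congr Ck_on; apply/seteqP; split=> v /=; first by move=> [[? ?] [? ?]]; split.
by move=> [[? ?] [? ?]]; split.
Qed.

Definition prod_manifold : manifold R :=
  Manifold prod_chart_at_dom prod_chart_at_compat
    (prod_hausdorff (@mhausdorff _ M) (@mhausdorff _ N))
    (prod_second_countable (@msecond_countable _ M) (@msecond_countable _ N)).

End ProdManifold.

End ProductManifold.

Definition prod_tangent (R : realType) (M N : manifold R) (p : prod_manifold M N)
    (v : tangent p.1) (w : tangent p.2) : tangent p :=
  row_mx (v : 'rV[R]_(mdim M)) (w : 'rV[R]_(mdim N)).
Arguments prod_tangent {R M N} p v w.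

Definition mdiff1 (R : realType) (M N Q : manifold R)
    (f : prod_manifold M N -> Q) (p : prod_manifold M N) (v : tangent p.1) :
    tangent (f p) :=
  mdiff f p (prod_tangent p v 0).
Arguments mdiff1 {R M N Q} f p v.

Record fiber_bundle (R : realType) := FiberBundle {
  btotal : manifold R ;
  bbase : manifold R ;
  bfiber : manifold R ;
  bproj : btotal -> bbase ;
  bproj_smooth : smooth_map bproj ;
  bproj_trivial : forall m : bbase, exists U : set bbase,
    [/\ open U, U m &
      exists Phi : btotal -> prod_manifold bbase bfiber,
        diffeo_on (bproj @^-1` U) [set q : prod_manifold bbase bfiber | U q.1] Phi /\
        (forall e, U (bproj e) -> (Phi e).1 = bproj e)] }.
Arguments bproj {R} _ _.

Section DLPS.
Context (R : realType).

Definition Cprime (b : fiber_bundle R) : manifold R :=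
  prod_manifold (btotal b) (bbase b).

Definition Csecond (b : fiber_bundle R) : Type :=
  {eta : Cprime b * Cprime b | eta.1.2 = bproj b eta.2.1}.

(* Csecond b is a graph; this is the induced global diffeomorphism
   E * (E * M) -> Csecond b, through which smoothness on Csecond b is expressed. *)
Definition Csecond_param (b : fiber_bundle R)
    (q : prod_manifold (btotal b) (prod_manifold (btotal b) (bbase b))) : Csecond b :=
  exist (fun eta : Cprime b * Cprime b => eta.1.2 = bproj b eta.2.1)
    ((q.1, bproj b q.2.1), (q.2.1, q.2.2)) erefl.

Definition eps0 (b : fiber_bundle R) (eta : Csecond b) : btotal b := (sval eta).1.1.
Definition eps1 (b : fiber_bundle R) (eta : Csecond b) : btotal b := (sval eta).2.1.

(* Smoothness: the matrix entries of P eta with respect to charts c around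
   eps1 and d around eps0 are smooth functions of eta. *)
Record chaining_map (b : fiber_bundle R) := ChainingMap {
  chain :> forall eta : Csecond b, {linear tangent (eps1 eta) -> tangent (eps0 eta)} ;
  chain_vertical : forall eta v, mdiff (bproj b) (eps0 eta) (chain eta v) = 0 ;
  chain_smooth : forall (x y : btotal b) (v : 'rV[R]_(mdim (btotal b))),
    let c := chart_at (btotal b) x in
    let d := chart_at (btotal b) y in
    @smooth_fun_on R (prod_manifold (btotal b) (prod_manifold (btotal b) (bbase b)))
      'rV[R]_(mdim (btotal b))
      [set q | chart_dom c q.2.1 /\ chart_dom d q.1]
      (fun q =>
         coord_change (chart_at (btotal b) q.1) d q.1
           (chain (Csecond_param q)
              (coord_change c (chart_at (btotal b) q.2.1) q.2.1 v))) }.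

Record dlps := DLPS {
  bundle : fiber_bundle R ;
  lagrangian : Cprime bundle -> R ;
  lagrangian_smooth : smooth_fun_on setT (lagrangian : _ -> R^o) ;
  chaining : chaining_map bundle }.

Section Morphisms.
Context (A B : dlps).
Let E := btotal (bundle A).
Let E' := btotal (bundle B).
Let phi : E -> bbase (bundle A) := bproj (bundle A).
Let phi' : E' -> bbase (bundle B) := bproj (bundle B).

Section Conditions.
Variable Y : Cprime (bundle A) -> Cprime (bundle B).

Let p1Y (q : Cprime (bundle A)) : E' := (Y q).1.
Let p2Y (q : Cprime (bundle A)) : bbase (bundle B) := (Y q).2.

Definition preserves_Csecond : Prop :=
  forall eta : Csecond (bundle A), p2Y (sval eta).1 = phi' (p1Y (sval eta).2).

Definition Csecond_map (H : preserves_Csecond) (eta : Csecond (bundle A)) : Csecond (bundle B) :=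
  exist (fun eta' : Cprime (bundle B) * Cprime (bundle B) => eta'.1.2 = bproj (bundle B) eta'.2.1)
    (Y (sval eta).1, Y (sval eta).2) (H eta).

Record is_morphism : Prop := IsMorphism {
  mor_surjective : forall q', exists q, Y q = q' ;
  mor_submersion : submersion Y ;
  mor_D1p1_onto : forall (q : Cprime (bundle A)) (w : tangent (p1Y q)),
    exists v : tangent q.1, mdiff1 p1Y q v = w ;
  mor_D1p2_zero : forall (q : Cprime (bundle A)) (v : tangent q.1),
    mdiff1 p2Y q v = 0 ;
  mor_Csecond : preserves_Csecond ;
  mor_lagrangian : forall q, lagrangian q = lagrangian (Y q) ;
  mor_chaining : forall (eta : Csecond (bundle A)) (v : tangent (eps1 eta)),
    chaining B (Csecond_map mor_Csecond eta) (mdiff1 p1Y (sval eta).2 v) =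
    mdiff p1Y (sval eta).1
      (prod_tangent (sval eta).1 (chaining A eta v)
        (mdiff phi (eps1 eta) v)) }.

End Conditions.

Record morphism := Morphism {
  mor_fun :> Cprime (bundle A) -> Cprime (bundle B) ;
  morP : is_morphism mor_fun }.

End Morphisms.

End DLPS.

Record is_category (Ob : Type) (Hom : Ob -> Ob -> Type)
    (idm : forall A, Hom A A)
    (comp : forall A B C, Hom B C -> Hom A B -> Hom A C) : Prop := IsCategory {
  cat_idl : forall A B (f : Hom A B), comp A B B (idm B) f = f ;
  cat_idr : forall A B (f : Hom A B), comp A A B f (idm A) = f ;
  cat_assoc : forall A B C D (h : Hom C D) (g : Hom B C) (f : Hom A B),
    comp A C D h (comp A B C g f) = comp A B D (comp B C D h g) f }.

(* Main.v *)
(** The only substantial point is that a composite [g o f] of morphisms is a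
    morphism. Since [D_1 (p_2 o f) = 0], the differential of [f] sends [(v, 0)] to
    [(D_1 (p_1 o f) v, 0)], so the conditions on [D_1] compose by the chain rule.
    For the chaining condition one also needs the second component of
    [df (P v, dphi v)]: differentiating in [e] the identity
    [p_2 (f (e_0, phi e)) = phi' (p_1 (f (e, m)))] shows that it is
    [dphi' (D_1 (p_1 o f) v)], so that the chaining condition of [g] applies to the
    image under [df] of the chaining vector. *)

Require Import Defs.
From HB Require Import structures.
From mathcomp Require Import all_boot all_order all_algebra.
From mathcomp Require Import all_classical all_reals all_analysis.
Set Implicit Arguments.
Unset Strict Implicit.
Unset Printing Implicit Defensive.
Import Order.TTheory GRing.Theory Num.Theory.
Import numFieldNormedType.Exports.
Local Open Scope classical_set_scope.
Local Open Scope ring_scope.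

(** * Calculus of [Ck_on]: locality, sums, products and composition *)

Section CkFunctions.
Context (R : realType).
Implicit Types V W X : normedModType R.

Lemma near_eq_diff V W (f g : V -> W) (x v : V) :
  (\near x, f x = g x) -> differentiable f x -> 'd f x v = 'd g x v.
Proof.
move=> fg fd; have gd := near_differentiable fg fd.
by rewrite -(deriveE v fd) -(deriveE v gd); exact: near_eq_derive.
Qed.

Lemma Ck_onW V W k (U : set V) (f : V -> W) : Ck_on k.+1 U f -> Ck_on k U f.
Proof.
elim: k f => [|k IH] f [fd fD].
  by move=> x Ux; exact: differentiable_continuous (fd x Ux).
by split=> // v; exact: IH (fD v).
Qed.

(** [Ck_on] only imposes conditions at the points of the set, so it can be checked point by point,
    with a different [B] at each point. *)
Lemma Ck_on_locally V W k (U : set V) (f : V -> W) :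
  (forall x, U x -> exists2 B : set V, B x & Ck_on k B f) -> Ck_on k U f.
Proof.
elim: k f => [|k IH] f H.
  by move=> x Ux; have [B Bx fB] := H x Ux; exact: fB.
split=> [x Ux|v]; first by have [B Bx [fd _]] := H x Ux; exact: fd.
by apply: IH => x Ux; have [B Bx [_ fD]] := H x Ux; exists B => //; exact: fD.
Qed.

Lemma Ck_on_subset V W k (U B : set V) (f : V -> W) :
  U `<=` B -> Ck_on k B f -> Ck_on k U f.
Proof. by move=> UB fB; apply: Ck_on_locally => x /UB Bx; exists B. Qed.

Lemma Ck_on_cst V W k (U : set V) (a : W) : Ck_on k U (cst a).
Proof.
elim: k a => [|k IH] a; first by move=> x _; exact: cst_continuous.
split=> [x _|v]; first exact: differentiable_cst.
by rewrite (_ : 'D_v (cst a) = cst 0)//; apply/funext => x; exact: derive_cst.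
Qed.

Lemma Ck_onD V W k (U : set V) (f g : V -> W) : open U ->
  Ck_on k U f -> Ck_on k U g -> Ck_on k U (f + g).
Proof.
move=> Uo; elim: k f g => [|k IH] f g.
  by move=> fc gc x Ux; exact: continuousD (fc x Ux) (gc x Ux).
move=> [fd fD] [gd gD]; split=> [x Ux|v].
  exact: differentiableD (fd x Ux) (gd x Ux).
apply: eq_Ck_on (IH _ _ (fD v) (gD v)) => // x Ux; symmetry.
by apply: deriveD; apply: diff_derivable; [exact: fd|exact: gd].
Qed.

Lemma Ck_on_sum V W k (U : set V) n (f : 'I_n -> V -> W) : open U ->
  (forall i, Ck_on k U (f i)) -> Ck_on k U (\sum_i f i).
Proof.
move=> Uo fU; elim/big_rec : _ => [|i g _]; first exact: Ck_on_cst.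
exact: Ck_onD.
Qed.

(** Registering scaling as a bilinear map makes its differential available for the product rule. *)
Lemma scale_is_bilinear W : bilinear_for
  (GRing.Scale.Law.clone _ _ *:%R _) (GRing.Scale.Law.clone _ _ *:%R _)
  ( *:%R : R^o -> W -> W).
Proof.
by split=> [u'|u] a x y /=; rewrite ?scalerDl ?scalerDr !scalerA// mulrC.
Qed.

HB.instance Definition _ W :=
  bilinear_isBilinear.Build R R^o W W _ _ ( *:%R : R^o -> W -> W)
    (@scale_is_bilinear W).

(** The product is the continuous bilinear map [*:%R] applied to the pair [(s, f)], so the chain
    rule gives the Leibniz formula. *)
Lemma differentiable_scale V W (s : V -> R^o) (f : V -> W) (x : V) :
  differentiable s x -> differentiable f x ->
  differentiable (fun y => s y *: f y) x /\
  forall v, 'D_v (fun y => s y *: f y) x = s x *: 'D_v f x + 'D_v s x *: f x.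
Proof.
move=> sd fd; have dp := differentiable_pair sd fd.
have bd := @differentiable_bilin _ _ _ _ ( *:%R : R^o -> W -> W) (s x, f x)
  (@scale_continuous _ W).
have dc := differentiable_comp dp bd.
split=> [//|v]; rewrite (deriveE _ dc) (deriveE _ sd) (deriveE _ fd).
have /(congr1 (@^~ v)) -> := diff_comp dp bd.
rewrite (diff_bilin _ (@scale_continuous _ W)) /=.
by have /(congr1 (@^~ v)) -> := diff_pair sd fd.
Qed.

Lemma Ck_on_scale V W k (U : set V) (s : V -> R^o) (f : V -> W) : open U ->
  Ck_on k U s -> Ck_on k U f -> Ck_on k U (fun x => s x *: f x).
Proof.
move=> Uo; elim: k s f => [|k IH] s f.
  by move=> sc fc x Ux; exact: cvgZ (sc x Ux) (fc x Ux).
move=> sC fC; have [[sd sD] [fd fD]] := (sC, fC).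
split=> [x Ux|v].
  by have [] := differentiable_scale (sd x Ux) (fd x Ux).
(* In each Leibniz term one factor is a derivative, of order [k] only; [Ck_onW] lowers the other
   factor to that order. *)
have := Ck_onD Uo (IH _ _ (Ck_onW sC) (fD v)) (IH _ _ (sD v) (Ck_onW fC)).
apply: eq_Ck_on => // x Ux.
by have [_ ->] := differentiable_scale (sd x Ux) (fd x Ux).
Qed.

(** A continuous linear map is its own differential, so ['D_v (l \o f)] is [l \o 'D_v f] on [U] and
    the induction goes through. *)
Lemma Ck_on_linear V W X k (U : set V) (l : {linear W -> X}) (f : V -> W) :
  open U -> continuous l -> Ck_on k U f -> Ck_on k U (l \o f).
Proof.
move=> Uo lc; elim: k f => [|k IH] f.
  by move=> fc x Ux; apply: continuous_comp; [exact: fc|exact: lc].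
move=> [fd fD]; have ld y : differentiable l y by exact: linear_differentiable.
split=> [x Ux|v]; first exact: differentiable_comp (fd x Ux) (ld _).
apply: eq_Ck_on (IH _ (fD v)) => // x Ux.
rewrite (deriveE _ (differentiable_comp (fd x Ux) (ld _))).
by rewrite (diff_comp (fd x Ux) (ld _)) (diff_lin _ lc) /= -deriveE//; exact: fd.
Qed.

Definition coord0 n (i : 'I_n) (v : 'rV[R]_n) : R^o := v 0 i.

Lemma coord0_is_linear n i : linear (@coord0 n i).
Proof. by move=> a u v; rewrite /coord0 !mxE. Qed.

HB.instance Definition _ n i :=
  GRing.isLinear.Build R 'rV[R]_n R^o _ (@coord0 n i) (@coord0_is_linear n i).

(* Induction on the order, through
   [D_v (g o f) = \sum_i (D_v f)_i *: (D_(e_i) g o f)]. *)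
Lemma Ck_on_comp V n W k (U : set V) (B : set 'rV[R]_n)
    (f : V -> 'rV[R]_n) (g : 'rV[R]_n -> W) :
  open U -> (forall x, U x -> B (f x)) ->
  Ck_on k U f -> Ck_on k B g -> Ck_on k U (g \o f).
Proof.
move=> Uo UB; elim: k g => [|k IH] g.
  by move=> fc gc x Ux; apply: continuous_comp; [exact: fc|exact/gc/UB].
move=> fC [gd gD]; have [fd fD] := fC.
split=> [x Ux|v]; first by apply: differentiable_comp; [exact: fd|exact/gd/UB].
pose t i := fun x => coord0 i ('D_v f x) *: 'D_('e_i) g (f x).
have tC : Ck_on k U (\sum_i t i).
  apply: Ck_on_sum => // i; apply: Ck_on_scale => //.
    exact: (@Ck_on_linear V 'rV[R]_n R^o k U (coord0 i) _ Uo
      (@coord_continuous R 1 n 0 i) (fD v)).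
  exact: IH (Ck_onW fC) (gD _).
apply: eq_Ck_on tC => // x Ux; rewrite fct_sumE /t.
have gx := gd _ (UB _ Ux).
have fx := fd x Ux.
rewrite (deriveE v (differentiable_comp fx gx)) (diff_comp fx gx) /=.
rewrite -(deriveE v fx) [in RHS](row_sum_delta ('D_v f x)) linear_sum.
by apply: eq_bigr => i _; rewrite (deriveE _ gx) linearZ.
Qed.

End CkFunctions.

(** * Smooth maps between manifolds and their differentials *)

Section Manifolds.
Context (R : realType).
Implicit Types M N Q : manifold R.

Lemma open_chart_preimage (T : topologicalType) n (c : chart R T n)
    (A : set T) :
  open A -> open (chart_cod c `&` chart_inv c @^-1` A).
Proof.
move=> Ao; rewrite openE => v [cv Av]; apply: filterI.
  by apply: open_nbhs_nbhs; split=> //; exact: chart_cod_open.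
by apply: (chart_inv_continuous cv); apply: open_nbhs_nbhs.
Qed.

Lemma near_chart_cod M (x : M) :
  \forall v \near chart_at M x x, chart_cod (chart_at M x) v.
Proof.
apply: open_nbhs_nbhs; split; first exact: chart_cod_open.
exact/chart_mapP/chart_at_dom.
Qed.

Lemma near_chart_inv M (x : M) (P : set M) : (\forall y \near x, P y) ->
  \forall v \near chart_at M x x, P (chart_inv (chart_at M x) v).
Proof.
have xd := chart_at_dom x; move=> Px.
apply: (chart_inv_continuous (chart_mapP xd)).
by rewrite /= chart_mapK.
Qed.

Lemma near_chart_dom M N (f : M -> N) (x : M) : {for x, continuous f} ->
  \forall y \near x, chart_dom (chart_at N (f x)) (f y).
Proof.
move=> fx; apply: fx; apply: open_nbhs_nbhs; split.
  exact: chart_dom_open.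
exact: chart_at_dom.
Qed.

Lemma smooth_map_continuous M N (f : M -> N) : smooth_map f -> continuous f.
Proof. by move=> [fc _] x; exact: fc. Qed.

(** In charts the identity is a transition map of the atlas. *)
Lemma smooth_map_id M : smooth_map (id : M -> M).
Proof.
split=> [x _|y x k]; first exact: cvg_id.
apply: Ck_on_subset (@chart_at_compat _ M x y k).
by move=> v [cv [_ dv]].
Qed.

Lemma smooth_map_comp M N Q (f : M -> N) (g : N -> Q) :
  smooth_map f -> smooth_map g -> smooth_map (g \o f).
Proof.
move=> fS gS; have fc := smooth_map_continuous fS.
have gc := smooth_map_continuous gS.
split=> [x _|y x k]; first by apply: continuous_comp; [exact: fc|exact: gc].
have Io (T : topologicalType) n (c : chart R T n) (h : M -> T) :
    continuous h -> open (setT `&` h @^-1` chart_dom c).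
  move=> hc; rewrite setTI; apply: open_comp; last exact: chart_dom_open.
  by move=> z _; exact: hc.
apply: Ck_on_locally => v [cv [_ dv]].
(* The intermediate chart is the one at the image of the given point. On the open set [B] both this
   chart and the target chart apply, so the local expression of [g \o f] factors there. *)
pose z := f (chart_inv (chart_at M x) v).
pose B := (chart_cod (chart_at M x) `&` chart_inv (chart_at M x) @^-1`
  (setT `&` (g \o f) @^-1` chart_dom (chart_at Q y))) `&`
  (chart_cod (chart_at M x) `&` chart_inv (chart_at M x) @^-1`
  (setT `&` f @^-1` chart_dom (chart_at N z))).
have Bo : open B.
  apply: openI; apply: open_chart_preimage; apply: Io => // u.
  by apply: continuous_comp; [exact: fc|exact: gc].
exists B; first by split; split=> //; split=> //; exact: chart_at_dom.
apply: (@eq_Ck_on _ _ _ _ _ ((chart_at Q y \o g \o chart_inv (chart_at N z)) \o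
    (chart_at N z \o f \o chart_inv (chart_at M x)))) => //.
  by move=> u [_ [_ [_ zu]]] /=; rewrite chart_mapK.
apply: (Ck_on_comp Bo _ _ (gS.2 y z k)).
  move=> u [[_ [_ yu]] [_ [_ zu]]]; split; first exact: chart_mapP.
  by split=> //=; rewrite chart_mapK.
by apply: Ck_on_subset (fS.2 z x k) => u [_].
Qed.

(** Charts are total functions with irrelevant values outside their domains. Continuity keeps [f]
    inside the chart domain at [f x] near [x], where its chart expression is meaningful. *)
Definition mdifferentiable M N (f : M -> N) (x : M) : Prop :=
  {for x, continuous f} /\
  differentiable (chart_at N (f x) \o f \o chart_inv (chart_at M x))
    (chart_at M x x).

Lemma smooth_mdifferentiable M N (f : M -> N) :
  smooth_map f -> forall x, mdifferentiable f x.
Proof.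
move=> fS x; split; first exact: smooth_map_continuous.
have [fd _] := fS.2 (f x) x 1%N; apply: fd.
have xd := chart_at_dom x.
split; first exact: chart_mapP.
by split=> //=; rewrite chart_mapK//; exact: chart_at_dom.
Qed.

(** The sides lie in the tangent spaces at [f x] and [g x], hence the comparison as rows of
    components. *)
Lemma eq_mdiff M N (f g : M -> N) (x : M) (v : tangent x) :
  f =1 g -> mdiff f x v = mdiff g x v :> 'rV[R]_(mdim N).
Proof. by move=> /funext ->. Qed.

(** Differentials depend only on germs: any formula [h] for [f] in charts near the point may be
    differentiated instead. The explicit differentials below come from this. *)
Lemma mdiff_near M N (f : M -> N) (x : M)
    (h : 'rV[R]_(mdim M) -> 'rV[R]_(mdim N)) :
  (\forall v \near chart_at M x x,
     h v = chart_at N (f x) (f (chart_inv (chart_at M x) v))) ->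
  {for x, continuous f} -> differentiable h (chart_at M x x) ->
  mdifferentiable f x /\
  forall v : tangent x, mdiff f x v = 'd h (chart_at M x x) v.
Proof.
move=> hf fc hd; split; first by split=> //; exact: near_differentiable hf hd.
by move=> v; symmetry; exact: (near_eq_diff v hf hd).
Qed.

(** The intermediate charts cancel as long as [f] stays in the chart domain at [f x], which holds
    near [x] by continuity; then the chain rule between row spaces applies. *)
Lemma mdiff_comp M N Q (f : M -> N) (g : N -> Q) (x : M) :
  mdifferentiable f x -> mdifferentiable g (f x) ->
  mdifferentiable (g \o f) x /\
  forall v : tangent x, mdiff (g \o f) x v = mdiff g (f x) (mdiff f x v).
Proof.
move=> [fc fd] [gc gd].
have xd := chart_at_dom x.
pose F := chart_at N (f x) \o f \o chart_inv (chart_at M x).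
pose G := chart_at Q (g (f x)) \o g \o chart_inv (chart_at N (f x)).
have FE : F (chart_at M x x) = chart_at N (f x) (f x) by rewrite /F /= chart_mapK.
have {}gd : differentiable G (F (chart_at M x x)) by rewrite FE.
have {}fd : differentiable F (chart_at M x x) by [].
have [] := @mdiff_near M Q (g \o f) x (G \o F).
- have := near_chart_inv (near_chart_dom fc); apply: filterS => v vd.
  by rewrite /G /F /= chart_mapK.
- exact: continuous_comp.
- exact: differentiable_comp.
move=> gfd E; split=> // v; rewrite E (diff_comp fd gd) /=.
by rewrite FE.
Qed.

Lemma mdiff_id M (x : M) :
  mdifferentiable (id : M -> M) x /\
  forall v : tangent x, mdiff (id : M -> M) x v = v.
Proof.
have [] := @mdiff_near M M id x id.
- by have := near_chart_cod x; apply: filterS => v vc; rewrite /= chart_invK.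
- exact: cvg_id.
- exact: ex_diff.
by move=> d E; split=> // v; rewrite E diff_val.
Qed.

Lemma mdiff_cst M N (x : M) (y : N) :
  mdifferentiable (fun _ : M => y) x /\
  forall v : tangent x, mdiff (fun _ : M => y) x v = 0.
Proof.
have [] := @mdiff_near M N (fun=> y) x (cst (chart_at N y y)).
- exact: (filterS (P := setT) _ filterT).
- exact: cst_continuous.
- exact: differentiable_cst.
by move=> d E; split=> // v; rewrite E diff_cst.
Qed.

(** Product charts concatenate coordinates, so in charts the projection is the linear map
    [lsubmx]. *)
Lemma mdiff_fst M N (p : prod_manifold M N) :
  mdifferentiable (fun q : prod_manifold M N => q.1) p /\
  forall v : tangent p, mdiff (fun q : prod_manifold M N => q.1) p v = lsubmx v.
Proof.
have [] := @mdiff_near (prod_manifold M N) M (fun q => q.1) p (@lsubmx _ _ _ _).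
- have := near_chart_cod p; apply: filterS => v -[vM vN] /=.
  by rewrite chart_invK.
- exact: cvg_fst.
- exact: differentiable_lsubmx.
move=> d E; split=> // v; rewrite E.
by rewrite (diff_lin _ (@continuous_lsubmx R 1 _ _)).
Qed.

Lemma mdiff_snd M N (p : prod_manifold M N) :
  mdifferentiable (fun q : prod_manifold M N => q.2) p /\
  forall v : tangent p, mdiff (fun q : prod_manifold M N => q.2) p v = rsubmx v.
Proof.
have [] := @mdiff_near (prod_manifold M N) N (fun q => q.2) p (@rsubmx _ _ _ _).
- have := near_chart_cod p; apply: filterS => v -[vM vN] /=.
  by rewrite chart_invK.
- exact: cvg_snd.
- exact: differentiable_rsubmx.
move=> d E; split=> // v; rewrite E.
by rewrite (diff_lin _ (@continuous_rsubmx R 1 _ _)).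
Qed.

(** In charts the pairing is the continuous linear map [row_pair] after the pair of chart
    expressions. *)
Lemma mdiff_pair M N Q (f : M -> N) (g : M -> Q) (x : M) :
  let h x : prod_manifold N Q := (f x, g x) in
  mdifferentiable f x -> mdifferentiable g x ->
  mdifferentiable h x /\
  forall v : tangent x,
    mdiff h x v = prod_tangent (h x) (mdiff f x v) (mdiff g x v).
Proof.
move=> h [fc fd] [gc gd].
pose F := chart_at N (f x) \o f \o chart_inv (chart_at M x).
pose G := chart_at Q (g x) \o g \o chart_inv (chart_at M x).
have FGd := differentiable_pair fd gd.
have rd (p : 'rV[R]_(mdim N) * 'rV[R]_(mdim Q)) :
    differentiable (@row_pair _ _ _) p.
  exact/linear_differentiable/row_pair_continuous.
have [] := @mdiff_near M (prod_manifold N Q) h x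
  (@row_pair _ _ _ \o (fun v => (F v, G v))).
- exact: (filterS (P := setT) _ filterT).
- exact: pair_continuous_at.
- exact: differentiable_comp.
move=> d E; split=> // v; rewrite E (diff_comp FGd (rd _)) /=.
have /(congr1 (@^~ (('d F (chart_at M x x) v), ('d G (chart_at M x x) v)))) :=
  @diff_lin _ _ _ (@row_pair R _ _) (F (chart_at M x x), G (chart_at M x x))
    (@row_pair_continuous _ _ _).
have /(congr1 (@^~ v)) -> := diff_pair fd gd.
exact.
Qed.

(** The chain rule with each projection identifies the two blocks of the row. *)
Lemma mdiff_prod M N Q (f : M -> prod_manifold N Q) (x : M) (v : tangent x) :
  mdifferentiable f x ->
  mdiff f x v = prod_tangent (f x) (mdiff (fun y => (f y).1) x v)
                                   (mdiff (fun y => (f y).2) x v).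
Proof.
move=> fd.
have E1 : mdiff (fun y => (f y).1) x v = lsubmx (mdiff f x v) :> 'rV[R]_(mdim N).
  rewrite -(mdiff_fst (f x)).2.
  exact: (mdiff_comp fd (mdiff_fst (f x)).1).2.
have E2 : mdiff (fun y => (f y).2) x v = rsubmx (mdiff f x v) :> 'rV[R]_(mdim Q).
  rewrite -(mdiff_snd (f x)).2.
  exact: (mdiff_comp fd (mdiff_snd (f x)).1).2.
by rewrite /prod_tangent E1 E2 hsubmxK.
Qed.

End Manifolds.

(** * Identities and composites in the category of discrete Lagrange--Poincaré systems *)

Section Category.
Context (R : realType).

Lemma mdiff1_fst (M N : manifold R) (p : prod_manifold M N) (v : tangent p.1) :
  mdiff1 (fun q : prod_manifold M N => q.1) p v = v.
Proof. by rewrite /mdiff1 (mdiff_fst p).2 row_mxKl. Qed.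

Lemma mdiff1_snd (M N : manifold R) (p : prod_manifold M N) (v : tangent p.1) :
  mdiff1 (fun q : prod_manifold M N => q.2) p v = 0.
Proof. by rewrite /mdiff1 (mdiff_snd p).2 row_mxKr. Qed.

(** Points of [Csecond] carry a proof of incidence; by proof irrelevance the underlying pair
    determines them. *)
Lemma eq_chaining (A : dlps R) (eta eta' : Csecond (bundle A))
    (v : tangent (eps1 eta)) :
  sval eta = sval eta' ->
  chaining A eta v = chaining A eta' v :> 'rV[R]_(mdim (btotal (bundle A))).
Proof. by move=> /(eq_sig_hprop (fun x p q => Prop_irrelevance p q)) e; subst. Qed.

Lemma id_is_morphism (A : dlps R) :
  is_morphism (id : Cprime (bundle A) -> Cprime (bundle A)).
Proof.
have idC : preserves_Csecond (id : Cprime (bundle A) -> Cprime (bundle A)).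
  by move=> eta; exact: svalP eta.
apply: (@IsMorphism _ A A id _ _ _ _ idC).
- by move=> q; exists q.
- split; first exact: smooth_map_id.
  by move=> q w; exists w; exact: (mdiff_id q).2.
- by move=> q w; exists w; exact: mdiff1_fst.
- by move=> q v; exact: mdiff1_snd.
- by move=> q.
- move=> eta v.
  (* Here [p_1] alone is differentiated: the right side keeps the first block, the chaining vector,
     and on the left [D_1 p_1] is the identity. *)
  rewrite [RHS](mdiff_fst (sval eta).1).2 row_mxKl.
  rewrite [X in chaining _ _ X](mdiff1_fst v).
  by apply: eq_chaining; rewrite /=; case: (sval eta).
Qed.

Lemma mor_mdifferentiable (A B : dlps R)
    (h : Cprime (bundle A) -> Cprime (bundle B)) :
  is_morphism h -> forall q, [/\ mdifferentiable h q,
    mdifferentiable (fun q => (h q).1) q & mdifferentiable (fun q => (h q).2) q].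
Proof.
move=> hM q; have hd := smooth_mdifferentiable (mor_submersion hM).1 q.
split=> //.
  exact: (mdiff_comp hd (mdiff_fst (h q)).1).1.
exact: (mdiff_comp hd (mdiff_snd (h q)).1).1.
Qed.

(** * Composites of morphisms *)

Section Composition.
Context (A B C : dlps R).
Variables (g : Cprime (bundle B) -> Cprime (bundle C))
          (f : Cprime (bundle A) -> Cprime (bundle B)).
Hypotheses (gM : is_morphism g) (fM : is_morphism f).

Lemma mdiff_mor1 (q : Cprime (bundle A)) (v : tangent q.1) :
  mdiff f q (prod_tangent q v 0) =
  prod_tangent (f q) (mdiff1 (fun q => (f q).1) q v) 0.
Proof.
have [fd _ _] := mor_mdifferentiable fM q.
rewrite mdiff_prod//.
by have := mor_D1p2_zero fM v; rewrite /mdiff1 => ->.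
Qed.

Lemma mdiff_p1_comp (q : Cprime (bundle A)) (w : tangent q) :
  mdiff (fun q => (g (f q)).1) q w =
  mdiff (fun q => (g q).1) (f q) (mdiff f q w).
Proof.
have [fd _ _] := mor_mdifferentiable fM q.
have [_ gd _] := mor_mdifferentiable gM (f q).
exact: (mdiff_comp fd gd).2.
Qed.

Lemma mdiff_p2_comp (q : Cprime (bundle A)) (w : tangent q) :
  mdiff (fun q => (g (f q)).2) q w =
  mdiff (fun q => (g q).2) (f q) (mdiff f q w).
Proof.
have [fd _ _] := mor_mdifferentiable fM q.
have [_ _ gd] := mor_mdifferentiable gM (f q).
exact: (mdiff_comp fd gd).2.
Qed.

Lemma mdiff1_p1_comp (q : Cprime (bundle A)) (v : tangent q.1) :
  mdiff1 (fun q => (g (f q)).1) q v =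
  mdiff1 (fun q => (g q).1) (f q) (mdiff1 (fun q => (f q).1) q v).
Proof. by rewrite /mdiff1 mdiff_p1_comp mdiff_mor1. Qed.

Lemma mdiff1_p2_comp (q : Cprime (bundle A)) (v : tangent q.1) :
  mdiff1 (fun q => (g (f q)).2) q v =
  mdiff1 (fun q => (g q).2) (f q) (mdiff1 (fun q => (f q).1) q v).
Proof. by rewrite /mdiff1 mdiff_p2_comp mdiff_mor1. Qed.

(* [u] is arbitrary because [D_1 (p_2 o f) = 0]. *)
Lemma mdiff_p2_mor (eta : Csecond (bundle A)) (u : tangent (eps0 eta))
    (v : tangent (eps1 eta)) :
  mdiff (fun q => (f q).2) (sval eta).1
    (prod_tangent (sval eta).1 u (mdiff (bproj (bundle A)) (eps1 eta) v)) =
  mdiff (bproj (bundle B)) (f (sval eta).2).1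
    (mdiff1 (fun q => (f q).1) (sval eta).2 v)
  :> 'rV[R]_(mdim (bbase (bundle B))).
Proof.
case: eta u v => -[[e0 m1] [e1 m2]] /= m1E; rewrite /eps0 /eps1 /=.
subst m1 => u v.
(* Splitting off [(u, 0)] isolates a term that vanishes by [mor_D1p2_zero]. *)
have -> : prod_tangent (e0, bproj (bundle A) e1) u
      (mdiff (bproj (bundle A)) e1 v) =
    prod_tangent (e0, bproj (bundle A) e1) u 0 +
    prod_tangent (e0, bproj (bundle A) e1) 0 (mdiff (bproj (bundle A)) e1 v).
  by rewrite /prod_tangent add_row_mx addr0 add0r.
rewrite linearD.
rewrite [X in X + _ = _](mor_D1p2_zero fM (q := (e0, bproj (bundle A) e1)) u).
rewrite add0r.
have pd := smooth_mdifferentiable (@bproj_smooth _ (bundle A)) e1.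
have p'd := smooth_mdifferentiable (@bproj_smooth _ (bundle B)) (f (e1, m2)).1.
(* The maps to differentiate at [e1] are built from [e -> (e0, phi e)], called [k1], and
   [e -> (e, m2)], called [k2]. *)
have [c0 c0E] := mdiff_cst e1 e0.
have [c2 c2E] := mdiff_cst e1 m2.
have [i1 i1E] := mdiff_id e1.
have [k1 k1E] := mdiff_pair c0 pd.
have [k2 k2E] := mdiff_pair i1 c2.
have [_ _ f2] := mor_mdifferentiable fM (e0, bproj (bundle A) e1).
have [_ f1 _] := mor_mdifferentiable fM (e1, m2).
have LHSE : mdiff (fun e => (f (e0, bproj (bundle A) e)).2) e1 v =
    mdiff (fun q => (f q).2) (e0, bproj (bundle A) e1)
      (prod_tangent (e0, bproj (bundle A) e1) 0 (mdiff (bproj (bundle A)) e1 v))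
    :> 'rV[R]_(mdim (bbase (bundle B))).
  etransitivity; first exact: (mdiff_comp k1 f2).2.
  by rewrite k1E c0E.
have RHSE : mdiff (fun e => bproj (bundle B) (f (e, m2)).1) e1 v =
    mdiff (bproj (bundle B)) (f (e1, m2)).1
      (mdiff1 (fun q => (f q).1) (e1, m2) v)
    :> 'rV[R]_(mdim (bbase (bundle B))).
  have [h2 h2E] := mdiff_comp k2 f1.
  etransitivity; first exact: (mdiff_comp h2 p'd).2.
  rewrite h2E /mdiff1.
  by rewrite k2E i1E c2E.
(* Both sides are now differentials of functions of [e] that coincide, by the condition on [Csecond]
   applied to the pairs [((e0, phi e), (e, m2))]. *)
rewrite -LHSE -RHSE; apply: eq_mdiff => e.
exact: mor_Csecond fM (@Csecond_param _ (bundle A) (e0, (e, m2))).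
Qed.

Lemma comp_is_morphism : is_morphism (g \o f).
Proof.
have gfC : preserves_Csecond (g \o f).
  by move=> eta; exact: mor_Csecond gM (Csecond_map (mor_Csecond fM) eta).
apply: (@IsMorphism _ A C (g \o f) _ _ _ _ gfC).
- move=> q; have [q' <-] := mor_surjective gM q.
  by have [q'' <-] := mor_surjective fM q'; exists q''.
- split.
    exact: smooth_map_comp (mor_submersion fM).1 (mor_submersion gM).1.
  move=> q w; have [u <-] := (mor_submersion gM).2 _ w.
  have [v <-] := (mor_submersion fM).2 _ u; exists v.
  have [fd _ _] := mor_mdifferentiable fM q.
  have [gd _ _] := mor_mdifferentiable gM (f q).
  exact: (mdiff_comp fd gd).2.
- move=> q w; have [u <-] := mor_D1p1_onto gM w.
  have [v <-] := mor_D1p1_onto fM u; exists v.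
  exact: mdiff1_p1_comp.
- move=> q v; etransitivity; first exact: mdiff1_p2_comp.
  exact: (mor_D1p2_zero gM (q := f q) (mdiff1 (fun q => (f q).1) q v)).
- by move=> q; rewrite (mor_lagrangian fM) (mor_lagrangian gM).
- move=> eta v.
  pose eta' := Csecond_map (mor_Csecond fM) eta.
  pose w : tangent (eps1 eta') := mdiff1 (fun q => (f q).1) (sval eta).2 v.
  transitivity (chaining C (Csecond_map (mor_Csecond gM) eta')
      (mdiff1 (fun q => (g q).1) (sval eta').2 w)).
    etransitivity.
      (* The two points of [Csecond] differ only in their proofs of incidence. *)
      by apply: (eq_chaining (eta' := Csecond_map (mor_Csecond gM) eta')).
    by congr (chaining _ _ _); exact: mdiff1_p1_comp.
  etransitivity; first exact: (mor_chaining gM w).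
  symmetry; etransitivity; first exact: mdiff_p1_comp.
  (* Both sides apply [d(p_1 o g)] at the same point. It remains to see that [df] sends
     [(P v, dphi v)] to [(P' w, dphi' w)]: the first block is the chaining condition of [f], the
     second is [mdiff_p2_mor]. *)
  congr (mdiff _ _ _).
  have [fd _ _] := mor_mdifferentiable fM (sval eta).1.
  etransitivity; first exact: mdiff_prod.
  by rewrite -(mor_chaining fM v) mdiff_p2_mor.
Qed.

End Composition.

(** Proof irrelevance removes the [is_morphism] field, so the category laws reduce to pointwise
    identities between functions, which hold by computation. *)
Lemma eq_morphism (A B : dlps R) (f g : morphism A B) : f =1 g -> f = g.
Proof.
case: f g => [f fM] [g gM] /= /funext fg; subst g.
by congr Morphism; exact: Prop_irrelevance.
Qed.

End Category.

Theorem proposition4p4 (R : realType) :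
  exists (idm : forall A : dlps R, morphism A A)
         (comp : forall A B C : dlps R,
            morphism B C -> morphism A B -> morphism A C),
    [/\ forall (A : dlps R) (q : Cprime (bundle A)), idm A q = q,
        forall (A B C : dlps R) (g : morphism B C) (f : morphism A B)
               (q : Cprime (bundle A)), comp A B C g f q = g (f q)
      & is_category idm comp].
Proof.
exists (fun A => Morphism (id_is_morphism A)).
exists (fun A B C g f => Morphism (comp_is_morphism (morP g) (morP f))).
by split=> //; split=> *; exact: eq_morphism.
Qed.
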